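(* Let $x \in \Sigma^*$ and $y \in \Sigma^+$. Then $x$ nearly $\theta$-commutes with $y$ (that is, $H(xy,\theta(y)x)=1$) if and only if there exist integers $i,j\ge 0$, a word $z\in\Sigma^+$ with $H(z,\theta(z))=1$, and a word $t\in \Sigma^*\cap \mathrm{P}_\theta$ such that one of the following holds: (1) $x=\theta(y)^i z y^j$ and $y=tz$; (2) $x=\theta(y)^i\theta(z)$ and $y=tz$; (3) $x=\theta(y)^i t y^j$ and $y=zt$.
   Context: $\Sigma$ is a finite non-empty alphabet, $\Sigma^*$ is the set of all words over $\Sigma$ including the empty word $\lambda$, and $\Sigma^+=\Sigma^*\setminus\{\lambda\}$. $\theta:\Sigma^*\to\Sigma^*$ is a fixed antimorphic involution: $\theta(uv)=\theta(v)\theta(u)$ for all $u,v\in\Sigma^*$ and $\theta^2$ is the identity (so $\theta$ maps letters to letters and preserves length). For words $p,q$ of equal length, $H(p,q)$ is the Hamming distance, i.e. the number of positions where $p$ and $q$ differ. $\mathrm{P}_\theta=\{w\in\Sigma^*: w=\theta(w)\}$ is the set of $\theta$-palindromes (including $\lambda$). For $x,y\in\Sigma^*$, $x$ nearly $\theta$-commutes with $y$ if $H(xy,\theta(y)x)=1$. *)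

(* Defs.v *)
From mathcomp Require Import all_boot.

Set Implicit Arguments.
Unset Strict Implicit.
Unset Printing Implicit Defensive.

Definition antimorphic_involution (Sigma : finType)
    (theta : seq Sigma -> seq Sigma) : Prop :=
  (forall u v : seq Sigma, theta (u ++ v) = theta v ++ theta u)
  /\ (forall u : seq Sigma, theta (theta u) = u).

(* Only meaningful for words of equal length, since [zip] truncates to the
   shorter one. An antimorphic involution preserves length, so all the uses
   below compare words of equal length. *)
Definition hamming (Sigma : finType) (p q : seq Sigma) : nat :=
  count (fun ab : Sigma * Sigma => ab.1 != ab.2) (zip p q).

Definition theta_palindrome (Sigma : finType)
    (theta : seq Sigma -> seq Sigma) (w : seq Sigma) : Prop :=
  w = theta w.

Definition nearly_theta_commutes (Sigma : finType)
    (theta : seq Sigma -> seq Sigma) (x y : seq Sigma) : Prop :=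
  hamming (x ++ y) (theta y ++ x) = 1.

Definition word_exp (Sigma : finType) (w : seq Sigma) (n : nat) : seq Sigma :=
  flatten (nseq n w).

(* Main.v *)
(** Cut off a block [theta y] on the left or [y] on the right of [x] as long as
    [size y < size x]: the first and the last [size y] positions of [x ++ y] are
    then disjoint, so the single mismatch leaves one of these two blocks intact,
    and cutting it off does not change the Hamming distance. Once
    [size x <= size y], write [y = u ++ v] with [size v = size x]; the distance is
    [H(x, theta v) + H(u, theta u) + H(v, x)], and the summand equal to 1 selects
    one of the three forms. *)
Require Import Defs.
From mathcomp Require Import all_boot.

Section Hamming.
Variable Sigma : finType.
Implicit Types (p q r s w : seq Sigma).

Lemma hammingxx p : hamming p p = 0.
Proof. by elim: p => //= a p; rewrite /hamming /= eqxx. Qed.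

Lemma hamming_cat p q r s : size p = size q ->
  hamming (p ++ r) (q ++ s) = hamming p q + hamming r s.
Proof. by move=> pq; rewrite /hamming zip_cat // count_cat. Qed.

Lemma hamming_catl p r s : hamming (p ++ r) (p ++ s) = hamming r s.
Proof. by rewrite hamming_cat // hammingxx. Qed.

Lemma hamming_catr p q r : size p = size q ->
  hamming (p ++ r) (q ++ r) = hamming p q.
Proof. by move=> pq; rewrite hamming_cat // hammingxx addn0. Qed.

Lemma hamming0_eq p q : size p = size q -> hamming p q = 0 -> p = q.
Proof.
elim: p q => [|a p IHp] [|b q] //= [pq]; rewrite /hamming /=.
by case: eqP => //= -> /(IHp _ pq) ->.
Qed.

Lemma word_expS w n : word_exp w n.+1 = w ++ word_exp w n.
Proof. by []. Qed.

Lemma word_expSr w n : word_exp w n.+1 = word_exp w n ++ w.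
Proof.
by elim: n => [|n IHn]; [exact: cats0 | rewrite word_expS {1}IHn catA].
Qed.

End Hamming.

Section AntimorphicInvolution.
Variables (Sigma : finType) (theta : seq Sigma -> seq Sigma).
Hypothesis theta_ai : antimorphic_involution theta.
Implicit Types (u v x y z : seq Sigma).

Let thetaD u v : theta (u ++ v) = theta v ++ theta u := theta_ai.1 u v.
Let thetaK u : theta (theta u) = u := theta_ai.2 u.

Lemma theta_nil : theta [::] = [::].
Proof.
have /(congr1 size) := thetaD [::] [::]; rewrite cats0 size_cat.
by move/esym/eqP; rewrite -[X in _ == X]addn0 eqn_add2l => /nilP.
Qed.

(** A letter cannot have an empty image, since applying [theta] twice would then give [[::]] instead
    of the letter. So [theta] shortens no word, and the involution turns this inequality into an
    equality. *)
Lemma size_theta u : size (theta u) = size u.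
Proof.
have le_theta v : size v <= size (theta v).
  elim: v => // a v IHv; rewrite -cat1s thetaD !size_cat addnC leq_add //.
  rewrite lt0n; apply/nilP => a0.
  by have := thetaK [:: a]; rewrite a0 theta_nil.
by apply/eqP; rewrite eqn_leq le_theta -{2}(thetaK u) le_theta.
Qed.

(** Powers of one word commute, so both compared words begin with [word_exp (theta y) i], which
    cancels. *)
Lemma nearly_theta_commutes_expl x y i :
  nearly_theta_commutes theta (word_exp (theta y) i ++ x) y <->
  nearly_theta_commutes theta x y.
Proof.
by rewrite /nearly_theta_commutes catA -word_expS word_expSr -!catA hamming_catl.
Qed.

(** Mirror image: here [word_exp y j] is a common suffix. *)
Lemma nearly_theta_commutes_expr x y j :
  nearly_theta_commutes theta (x ++ word_exp y j) y <->
  nearly_theta_commutes theta x y.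
Proof.
rewrite /nearly_theta_commutes -catA -word_expSr word_expS !catA hamming_catr //.
by rewrite !size_cat size_theta addnC.
Qed.

Definition near_commutation_forms x y : Prop :=
  exists (i j : nat) (z t : seq Sigma),
    [/\ z <> [::],
        hamming z (theta z) = 1,
        theta_palindrome theta t
      & [\/ x = word_exp (theta y) i ++ z ++ word_exp y j /\ y = t ++ z,
            x = word_exp (theta y) i ++ theta z /\ y = t ++ z
          | x = word_exp (theta y) i ++ t ++ word_exp y j /\ y = z ++ t]].

Lemma near_commutation_forms_catl x y :
  near_commutation_forms x y -> near_commutation_forms (theta y ++ x) y.
Proof.
move=> [i] [j] [z] [t] [z0 z1 pt H]; exists i.+1, j, z, t; split=> //.
rewrite word_expS -!catA.
by case: H => -[-> yE]; [constructor 1 | constructor 2 | constructor 3].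
Qed.

(* The second form has no factor [y ^ j], but
   [theta z ++ y = theta z ++ t ++ z = theta y ++ z] is of the first form. *)
Lemma near_commutation_forms_catr x y :
  near_commutation_forms x y -> near_commutation_forms (x ++ y) y.
Proof.
move=> [i] [j] [z] [t] [z0 z1 pt [] [xE yE]].
- exists i, j.+1, z, t; split=> //; apply: Or31; split=> //.
  by rewrite xE word_expSr -!catA.
- exists i.+1, 0, z, t; split=> //; apply: Or31; split=> //.
  rewrite cats0 word_expSr xE -!catA; congr (_ ++ _).
  by rewrite yE thetaD -pt catA.
- exists i, j.+1, z, t; split=> //; apply: Or33; split=> //.
  by rewrite xE word_expSr -!catA.
Qed.

Lemma hamming_theta_neq_nil z : hamming z (theta z) = 1 -> z <> [::].
Proof. by move=> z1 z0; rewrite z0 theta_nil in z1. Qed.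

Lemma near_commutation_forms_short x y : size x <= size y ->
  nearly_theta_commutes theta x y -> near_commutation_forms x y.
Proof.
move=> le_xy; rewrite /nearly_theta_commutes.
set u := take (size y - size x) y; set v := drop (size y - size x) y.
have yE : y = u ++ v by rewrite cat_take_drop.
have sv : size v = size x by rewrite size_drop subKn.
clearbody u v; subst y; rewrite thetaD -catA !hamming_cat ?size_theta //.
have xv0 : hamming x (theta v) = 0 -> x = theta v.
  by apply: hamming0_eq; rewrite size_theta.
have uu0 : hamming u (theta u) = 0 -> u = theta u.
  by apply: hamming0_eq; rewrite size_theta.
have vx0 : hamming v x = 0 -> v = x by exact: hamming0_eq.
case xvE: (hamming x (theta v)) => [|[|?]] //.
  (* The first summand vanishes. A mismatch between [v] and [x = theta v] gives form (2) with
     [z = v] and [t = u]. *)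
  have xv := xv0 xvE; rewrite add0n.
  case uuE: (hamming u (theta u)) => [|[|?]] //.
    rewrite add0n => vxE; have pu := uu0 uuE.
    have z1 : hamming v (theta v) = 1 by rewrite -xv.
    exists 0, 0, v, u; split=> //; first exact: hamming_theta_neq_nil.
    by apply: Or32.
  (* Mismatch between [u] and [theta u]: then [v = x = theta v] serves as [t] and [z = u], which is
     form (3). *)
  case: (hamming v x) vx0 => // /(_ erefl) vx _.
  exists 0, 0, u, v; split=> //; first exact: hamming_theta_neq_nil.
    by rewrite /theta_palindrome -xv.
  by apply: Or33; rewrite /= cats0.
(* The first summand is 1: then [u] is a palindrome and [v = x], which is form (1) with [z = v]. *)
case uuE: (hamming u (theta u)) => //.
case: (hamming v x) vx0 => // /(_ erefl) vx _.
rewrite -vx in xvE *; exists 0, 0, v, u; split=> //.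
- exact: hamming_theta_neq_nil.
- exact: uu0.
- by apply: Or31; rewrite /= cats0.
Qed.

Lemma nearly_theta_commutes_long x y : size y <= size x ->
  nearly_theta_commutes theta x y ->
  (exists x', x = theta y ++ x') \/ (exists x', x = x' ++ y).
Proof.
move=> le_yx; rewrite /nearly_theta_commutes => H.
have sp : size (take (size y) x) = size (theta y) by rewrite size_theta size_takel.
case pE: (hamming (take (size y) x) (theta y)) => [|k].
  left; exists (drop (size y) x).
  by rewrite -(hamming0_eq _ _ _ sp pE) cat_take_drop.
right; exists (take (size x - size y) x).
set w := take (size x - size y) x; set s := drop (size x - size y) x.
have ss : size s = size y by rewrite size_drop subKn.
have xE : x = w ++ s by rewrite cat_take_drop.
have xE' : x = take (size y) x ++ drop (size y) x by rewrite cat_take_drop.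
have s0 : hamming y s = 0.
  (* The distance is now split as [H(x, theta y ++ w) + H(y, s)]; the first block of [x] already
     contributes at least 1 to the first summand, so the second is 0. *)
  have sw : size x = size (theta y ++ w).
    by rewrite {1}xE !size_cat size_theta ss addnC.
  move: H; rewrite {2}xE catA (hamming_cat _ _ _ _ _ sw) {1}xE'.
  rewrite (hamming_cat _ _ _ _ _ sp) pE !addSn => -[].
  by case: (hamming y s) => // ?; rewrite addnS.
by rewrite {1}xE (hamming0_eq _ _ _ (esym ss) s0).
Qed.

Lemma near_commutation_formsP x y : y <> [::] ->
  nearly_theta_commutes theta x y <-> near_commutation_forms x y.
Proof.
move=> y0; split.
  have [n] := ubnP (size x); elim: n x => // n IHn x ltxn H.
  (* As [y] is non-empty, each cut strictly shortens [x], so the induction on [size x] applies. *)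
  have y_gt0 : 0 < size y by rewrite lt0n; apply/nilP.
  have shorter x' : size x = size y + size x' -> size x' < n.
    move=> sx; apply: leq_trans (ltxn : size x <= n).
    by rewrite sx -[X in X < _]add0n ltn_add2r.
  case: (leqP (size x) (size y)) => [le_xy | /ltnW le_yx].
    exact: near_commutation_forms_short.
  case: (nearly_theta_commutes_long _ _ le_yx H) => -[x' xE]; rewrite xE in H *.
    apply: near_commutation_forms_catl; apply: IHn.
      by apply: shorter; rewrite xE size_cat size_theta.
    by apply/(nearly_theta_commutes_expl _ _ 1); rewrite /word_exp /= cats0.
  apply: near_commutation_forms_catr; apply: IHn.
    by apply: shorter; rewrite xE size_cat addnC.
  by apply/(nearly_theta_commutes_expr _ _ 1); rewrite /word_exp /= cats0.
(* Conversely, once the powers are stripped, the three forms compare [z t z] with [theta(z) t z],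
   [theta(z) t z] with [theta(z) t theta(z)], and [t z t] with [t theta(z) t]; each time the
   distance is [H(z, theta z)], up to symmetry of roles. *)
move=> [i] [j] [z] [t] [_ z1 pt [] [-> yE]]; apply/nearly_theta_commutes_expl.
- apply/nearly_theta_commutes_expr; rewrite /nearly_theta_commutes yE thetaD -pt.
  by rewrite -catA hamming_cat ?size_theta // hammingxx addn0.
- rewrite /nearly_theta_commutes yE thetaD -pt -catA !hamming_catl.
  exact: z1.
- apply/nearly_theta_commutes_expr; rewrite /nearly_theta_commutes yE thetaD -pt.
  by rewrite -catA hamming_catl hamming_catr ?size_theta.
Qed.

End AntimorphicInvolution.

Theorem theorem3p7 (Sigma : finType) (Sigma_nonempty : 0 < #|Sigma|)
    (theta : seq Sigma -> seq Sigma)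
    (theta_antimorphic_involution : antimorphic_involution theta)
    (x y : seq Sigma) (y_nonempty : y <> [::]) :
  nearly_theta_commutes theta x y <->
  exists (i j : nat) (z t : seq Sigma),
    [/\ z <> [::],
        hamming z (theta z) = 1,
        theta_palindrome theta t
      & [\/ x = word_exp (theta y) i ++ z ++ word_exp y j /\ y = t ++ z,
            x = word_exp (theta y) i ++ theta z /\ y = t ++ z
          | x = word_exp (theta y) i ++ t ++ word_exp y j /\ y = z ++ t]].
Proof. exact: near_commutation_formsP. Qed.
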